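(* Let $k\in\mathbb N$, $k\ge2$, and let $E$ be a symmetric space with the Fatou property. If $E^d$ is compactly locally fully $k$-rotund and strictly $K$-monotone, then $E$ is upper locally uniformly $K$-monotone.
   Context: Let $I=[0,\alpha)$, $\alpha=1$ or $\alpha=\infty$, with Lebesgue measure $\mu$, and $L^0$ the set of (classes of) extended real valued measurable functions on $I$. A Banach function space $(E,\|\cdot\|_E)$ is a Banach lattice that is a sublattice of $L^0$ such that (1) if $x\in L^0$, $y\in E$, $|x|\le|y|$ a.e., then $x\in E$ and $\|x\|_E\le\|y\|_E$; (2) there is a strictly positive $x\in E$. $E^+=\{x\in E:x\ge0\}$; $S_E$ is the unit sphere. Fatou property: if $(x_n)\subset E^+$, $\sup_n\|x_n\|_E<\infty$ and $x_n\uparrow x\in L^0$, then $x\in E$ and $\|x_n\|_E\uparrow\|x\|_E$. For $x\in L^0$: $d_x(\lambda)=\mu\{s\in I:|x(s)|>\lambda\}$, $x^*(t)=\inf\{\lambda>0:d_x(\lambda)\le t\}$, $x^{**}(t)=\frac1t\int_0^t x^*(s)\,ds$. A symmetric space is a Banach function space $E$ such that $x\in L^0$, $y\in E$, $d_x=d_y$ imply $x\in E$ and $\|x\|_E=\|y\|_E$. $x\prec y$ means $x^{**}(t)\le y^{**}(t)$ for all $t>0$. $E^d=\{x^*:x\in E\}$ (the cone of nonnegative decreasing elements). A property is said to hold on $E^d$ if its definition holds when only elements of $E^d$ are considered. $E^d$ is compactly locally fully $k$-rotund if for every $x\in S_E\cap E^d$, every sequence $(x_n)\subset S_E\cap E^d$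 such that $\|x+\sum_{i=1}^k x_{n,i}\|_E\to k+1$ as $n\to\infty$ for any $k$ subsequences $(x_{n,1})_n,\dots,(x_{n,k})_n$ of $(x_n)$ forms a relatively compact set. $E$ is strictly $K$-monotone if $x,y\in E$, $x\prec y$, $x^*\ne y^*$ imply $\|x\|_E<\|y\|_E$ (since this depends only on $x^*,y^*$, it is the same condition on $E^d$ as on $E$). $E$ is upper locally uniformly $K$-monotone if for every $x\in E$ and every $(x_n)\subset E$ with $x\prec x_n$ for all $n$ and $\|x_n\|_E\to\|x\|_E$ one has $\|x^*-x_n^*\|_E\to0$. *)

(* Defs.v *)
From mathcomp Require Import all_boot all_order all_algebra.
From mathcomp Require Import all_classical all_reals all_analysis.
From mathcomp Require Import measurable_realfun.
Set Implicit Arguments.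
Unset Strict Implicit.
Unset Printing Implicit Defensive.
Import Order.TTheory GRing.Theory Num.Theory.
Import numFieldNormedType.Exports.
Local Open Scope classical_set_scope.
Local Open Scope ring_scope.

Section Rearrangement.
Context {R : realType}.
Implicit Types (I : set R) (x y : R -> \bar R).

Local Notation mu := (@lebesgue_measure R).

(* A class in L^0(I) is handled through a representative R -> \bar R, of which
   only the restriction to I matters; equality of classes is a.e. equality
   on I. *)
Definition eqL0 I x y : Prop := x = y %[ae mu in I].

Definition leL0 I x y : Prop := {ae mu, forall t, I t -> (x t <= y t)%E}.

Definition distf I x (l : R) : \bar R :=
  mu (I `&` [set s | (l%:E < `|x s|)%E]).

(* x^*, with inf of the empty set equal to +oo. *)
Definition rearr I x (t : R) : \bar R :=
  ereal_inf [set l%:E | l in [set l : R | 0 < l /\ (distf I x l <= t%:E)%E]].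

(* x^**; when I = [0, 1), rearr I x vanishes on [1, +oo), which is the usual
   extension of x^* beyond I. *)
Definition mrearr I x (t : R) : \bar R :=
  (t^-1%:E * \int[mu]_(s in `[0%R, t]) rearr I x s)%E.

Definition Kprec I x y : Prop :=
  forall t : R, 0 < t -> (mrearr I x t <= mrearr I y t)%E.

End Rearrangement.

(* A Banach function space on I is a Banach space E together with an
   embedding iota : E -> L^0(I), iota e being a representative of the class e.
   "The function f is in E" reads "eqL0 I (iota e) f for some e : E", and
   this e is then unique. *)
Section FunctionSpaces.
Context {R : realType} (I : set R) {E : completeNormedModType R}.
Variable iota : E -> R -> \bar R.

Local Notation mu := (@lebesgue_measure R).

Record banach_function_space : Prop := {
  bfs_measurable : forall e, measurable_fun I (iota e);
  (* Automatic for a vector sublattice of L^0(I) with a norm monotone for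
     |.| <= |.|; it makes the pointwise operations below meaningful a.e. *)
  bfs_fin : forall e, {ae mu, forall t, I t -> iota e t \is a fin_num};
  bfs_inj : forall e f, eqL0 I (iota e) (iota f) -> e = f;
  bfs_add : forall e f,
    eqL0 I (iota (e + f)) (fun t => iota e t + iota f t)%E;
  bfs_scale : forall (a : R) e,
    eqL0 I (iota (a *: e)) (fun t => a%:E * iota e t)%E;
  bfs_max : forall e f, exists g,
    eqL0 I (iota g) (fun t => Order.max (iota e t) (iota f t));
  bfs_min : forall e f, exists g,
    eqL0 I (iota g) (fun t => Order.min (iota e t) (iota f t));
  bfs_ideal : forall (x : R -> \bar R) (f : E), measurable_fun I x ->
    leL0 I (fun t => `|x t|%E) (fun t => `|iota f t|%E) ->
    exists2 e, eqL0 I (iota e) x & `|e| <= `|f|;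
  bfs_weak_unit : exists e, {ae mu, forall t, I t -> (0 < iota e t)%E} }.

Record symmetric_space : Prop := {
  sym_bfs : banach_function_space;
  sym_equimeasurable : forall (x : R -> \bar R) (f : E), measurable_fun I x ->
    distf I x = distf I (iota f) ->
    exists2 e, eqL0 I (iota e) x & `|e| = `|f| }.

Definition fatou_property : Prop :=
  forall (x_ : nat -> E) (x : R -> \bar R), measurable_fun I x ->
    (forall n, leL0 I (cst 0%E) (iota (x_ n))) ->
    has_ubound (range (fun n => `|x_ n|)) ->
    {ae mu, forall t, I t -> nondecreasing_seq (fun n => iota (x_ n) t) /\
                             iota (x_ n) t @[n --> \oo] --> x t} ->
    exists e, [/\ eqL0 I (iota e) x, nondecreasing_seq (fun n => `|x_ n|)
                & `|x_ n| @[n --> \oo] --> `|e|].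

Definition decreasing_cone : set E :=
  [set e | exists f, eqL0 I (iota e) (rearr I (iota f))].

Definition unit_sphere : set E := [set e | `|e| = 1].

(* The strictly increasing maps s i : nat -> nat, i < k, select the k
   subsequences. *)
Definition compactly_locally_fully_rotund_on (D : set E) (k : nat) : Prop :=
  forall (x : E) (x_ : nat -> E),
    (unit_sphere `&` D) x -> (forall n, (unit_sphere `&` D) (x_ n)) ->
    (forall s : 'I_k -> nat -> nat,
      (forall i, {homo s i : m n / (m < n)%N}) ->
      `|x + \sum_(i < k) x_ (s i n)| @[n --> \oo] --> (k.+1%:R : R)) ->
    precompact (range x_).

Definition strictly_Kmonotone_on (D : set E) : Prop :=
  forall x y : E, D x -> D y -> Kprec I (iota x) (iota y) ->
    ~ eqL0 I (rearr I (iota x)) (rearr I (iota y)) -> `|x| < `|y|.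

(* xs and xs_ n are the elements x^* and x_n^* of E. *)
Definition upper_locally_uniformly_Kmonotone : Prop :=
  forall (x : E) (x_ : nat -> E),
    (forall n, Kprec I (iota x) (iota (x_ n))) ->
    `|x_ n| @[n --> \oo] --> `|x| ->
    exists (xs : E) (xs_ : nat -> E),
      [/\ eqL0 I (iota xs) (rearr I (iota x)),
          forall n, eqL0 I (iota (xs_ n)) (rearr I (iota (x_ n)))
        & `|xs - xs_ n| @[n --> \oo] --> (0 : R)].

End FunctionSpaces.

(* Main.v *)
Require Import Defs.
From mathcomp Require Import all_boot all_order all_algebra.
From mathcomp Require Import all_classical all_reals all_analysis.
From mathcomp Require Import measurable_realfun.
Set Implicit Arguments.
Unset Strict Implicit.
Unset Printing Implicit Defensive.
Import Order.TTheory GRing.Theory Num.Theory.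
Import numFieldNormedType.Exports.
Local Open Scope classical_set_scope.
Local Open Scope ring_scope.

(* If x is K-dominated by x_n and the norms converge, then after normalization
   (k+1) x^* is K-dominated by x^* plus k terms of the sequence (x_n^* ), so
   K-monotonicity forces the norms of these sums to k+1 and rotundity makes
   (x_n^* ) relatively compact.  Let p be a cluster point, approached by a
   subsequence w_j with summable distances.  By the Fatou property the sum of
   the |w_j - p| is in E, hence finite a.e.; thus w_j tends to p a.e., p is
   a.e. decreasing, and sup_j w_j is a decreasing element of E.  Strict
   K-monotonicity makes every element locally integrable near 0 (otherwise 2y
   would be K-dominated by y), so this supremum dominates the w_j in L^1(0, t)
   and x is K-dominated by p in the limit.  Both have the same norm, whence
   p = x^* by strict K-monotonicity. *)

(** * Decreasing rearrangement *)

Section Profiles.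
Context {R : realType} (I : set R).
Hypothesis hI : I = `[0%R, 1%R[%classic \/ I = `[0%R, +oo[%classic.
Local Notation mu := (@lebesgue_measure R).
Implicit Types (f g h : R -> \bar R) (s t l : R).

Lemma domain_measurable : measurable I.
Proof. by case: hI => ->; exact: measurable_itv. Qed.

Lemma domain_ge0 s : I s -> 0 <= s.
Proof. by case: hI => ->; rewrite /= in_itv/= => /andP[]. Qed.

Lemma domain_down s t : 0 <= s -> s <= t -> I t -> I s.
Proof.
case: hI => -> s0 st; rewrite /= !in_itv/= s0 //= => /andP[_].
exact: le_lt_trans.
Qed.

Lemma domain_mu_le t : 0 <= t -> ~ I t -> (mu I <= t%:E)%E.
Proof.
case: hI => ->; rewrite /= in_itv/= => -> /=; last by move=> [].
move=> /negP; rewrite -leNgt => t1.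
by rewrite lebesgue_measure_itv/= lte01 sube0 lee_fin.
Qed.

Lemma distf_measurable f l : measurable_fun I f ->
  measurable (I `&` [set s | (l%:E < `|f s|)%E]).
Proof.
move=> mf.
apply: (@emeasurable_fun_o_infty _ _ _ I (fun x => `|f x|)%E).
  exact: domain_measurable.
exact: measurableT_comp.
Qed.

Lemma distf_le f l l' : measurable_fun I f -> l <= l' ->
  (distf I f l' <= distf I f l)%E.
Proof.
move=> mf ll'; apply: le_measure.
- by rewrite inE; exact: distf_measurable.
- by rewrite inE; exact: distf_measurable.
- by move=> s [Is] /= h; split => //=; apply: le_lt_trans h; rewrite lee_fin.
Qed.

Lemma ae_mono (P Q : R -> Prop) : (forall s, P s -> Q s) ->
  {ae mu, forall s, P s} -> {ae mu, forall s, Q s}.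
Proof. by move=> PQ; apply: (@filterS _ _ (ae_filter_ringOfSetsType mu)). Qed.

Lemma ae_mono2 (P Q S : R -> Prop) : (forall s, P s -> Q s -> S s) ->
  {ae mu, forall s, P s} -> {ae mu, forall s, Q s} -> {ae mu, forall s, S s}.
Proof. by move=> PQ; apply: (@filterS2 _ _ (ae_filter_ringOfSetsType mu)). Qed.

Lemma eqL0_sym f g : eqL0 I f g -> eqL0 I g f.
Proof. by apply: ae_mono => s /[apply] ->. Qed.

Lemma eqL0_trans f g h : eqL0 I f g -> eqL0 I g h -> eqL0 I f h.
Proof. by apply: ae_mono2 => s fg gh Is; rewrite fg// gh. Qed.

Lemma distf_ae f g : measurable_fun I f -> measurable_fun I g ->
  eqL0 I f g -> distf I f = distf I g.
Proof.
have H f' g' l : measurable_fun I f' -> measurable_fun I g' ->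
    eqL0 I f' g' -> (distf I f' l <= distf I g' l)%E.
  move=> mf mg fg.
  have mD := measurableD (distf_measurable l mf) (distf_measurable l mg).
  rewrite /distf.
  set A := I `&` _ in mD *; set B := I `&` _ in mD *.
  have AB0 : mu (A `\` B) = 0.
    apply/negligibleP => //; apply: negligibleS fg.
    move=> s [[Is As] nB] /= /(_ Is) e; apply: nB; split => //=.
    by rewrite -e.
  have mA : measurable A by exact: distf_measurable.
  have mB : measurable B by exact: distf_measurable.
  rewrite -[leRHS]add0e -AB0.
  rewrite -measureU//; last by rewrite setDKI.
  apply: le_measure; rewrite ?inE //; first exact: measurableU.
  by move=> s As; case: (pselect (B s)) => Bs; [right|left].
move=> mf mg fg; apply/funext => l; apply/eqP; rewrite eq_le.
by rewrite !H//; exact: eqL0_sym.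
Qed.

(** Continuity of the measure from below: the superlevel set at [l] is the increasing union of those
    at [l + 1/(n+1)]. *)
Lemma distf_rcont f l t : measurable_fun I f -> 0 <= t ->
  (t%:E < distf I f l)%E ->
  exists2 l', l < l' & (t%:E < distf I f l')%E.
Proof.
move=> mf t0 tl.
apply: contrapT => /forall2NP H.
have {}H n : (distf I f (l + n.+1%:R^-1) <= t%:E)%E.
  have [//|/negP] := H (l + n.+1%:R^-1); last by rewrite -leNgt.
  by rewrite ltrDl invr_gt0 ltr0n.
pose F n := I `&` [set s | ((l + n.+1%:R^-1)%:E < `|f s|)%E].
have FE : \bigcup_n F n = I `&` [set s | (l%:E < `|f s|)%E].
  apply/seteqP; split => [s [n _ [Is /= h]]|s [Is /=]].
    split=> //=; apply: le_lt_trans h.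
    by rewrite lee_fin lerDl invr_ge0 ler0n.
  case E : `|f s|%E => [r| |] // lr.
    move: lr; rewrite lte_fin -subr_gt0 => lr.
    have [n _ /(_ n (leqnn n)) /= hn] := near_infty_natSinv_lt (PosNum lr).
    exists n => //; split => //=; rewrite E lte_fin.
    by rewrite addrC -ltrBrDr.
  by exists 0%N => //; split => //=; rewrite E ltry.
have : mu \o F @ \oo --> distf I f l.
  rewrite /distf -FE; apply: nondecreasing_cvg_mu.
  - by move=> n; exact: distf_measurable.
  - by rewrite FE; exact: distf_measurable.
  - move=> m n mn; apply/subsetPset => s [Is /= h]; split => //=.
    apply: le_lt_trans h; rewrite lee_fin lerD2l lef_pV2 ?posrE ?ltr0n//.
    by rewrite ler_nat.
move=> cv; have : (distf I f l <= t%:E)%E.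
  by apply: (cvge_to_le cv); apply: nearW => n; exact: H.
by rewrite leNgt tl.
Qed.

(** The separating level is rational so that the exceptional sets in [rearr_ae_nonincreasing] are
    countably indexed. *)
Lemma ereal_rat_between (a b : \bar R) : (0 <= a)%E -> (a < b)%E ->
  exists2 q : rat, (a < (ratr q)%:E)%E & ((ratr q)%:E < b)%E.
Proof.
case: a => [a| |] // a0; case: b => [b| |] //.
  rewrite lte_fin => /rat_in_itvoo[q]; rewrite in_itv/= => /andP[? ?].
  by exists q; rewrite lte_fin.
move=> _; have /rat_in_itvoo[q] : a < a + 1 by rewrite ltrDl.
rewrite in_itv/= => /andP[? ?].
by exists q; rewrite ?lte_fin ?ltry.
Qed.

Lemma lee_of_lt (a b : \bar R) : (0 <= b)%E ->
  (forall l, 0 <= l -> (l%:E < a)%E -> (l%:E <= b)%E) -> (a <= b)%E.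
Proof.
move=> b0 H; rewrite leNgt; apply/negP => /(ereal_rat_between b0)[q bq qa].
have q0 : 0 <= ratr q :> R by rewrite -lee_fin (le_trans b0)// ltW.
by have := le_lt_trans (H _ q0 qa) bq; rewrite ltxx.
Qed.

Lemma rearr_ge0 f t : (0 <= rearr I f t)%E.
Proof. by apply: le_ereal_inf_tmp => _ [l [l0 _] <-]; rewrite lee_fin ltW. Qed.

Lemma rearr_le f s t : s <= t -> (rearr I f t <= rearr I f s)%E.
Proof.
move=> st; apply: le_ereal_inf_tmp => _ [l [l0 ls] <-].
apply: ereal_inf_lbound; exists l => //; split => //.
by apply: le_trans ls _; rewrite lee_fin.
Qed.

(** Right-continuity of [distf] makes the rearrangement its exact generalized inverse. Inequalities
    between rearrangements are checked level by level through this equivalence. *)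
Lemma lt_rearr f l t : measurable_fun I f -> 0 <= l -> 0 <= t ->
  (l%:E < rearr I f t)%E = (t%:E < distf I f l)%E.
Proof.
move=> mf l0 t0; apply/idP/idP => [lr|td].
  rewrite ltNge; apply/negP => dt.
  (* The infimum in [rearr] runs over positive levels only, so the level 0 is approached by
     [l + e]. *)
  move: l0; rewrite le_eqVlt => /predU1P[l0|l0]; last first.
    have : (rearr I f t <= l%:E)%E by apply: ereal_inf_lbound; exists l.
    by rewrite leNgt lr.
  have : (rearr I f t <= l%:E)%E.
    apply/lee_addgt0Pr => e e0; rewrite -EFinD.
    apply: ereal_inf_lbound; exists (l + e) => //.
    split; first by rewrite -l0 add0r.
    by apply: le_trans dt; apply: distf_le => //; rewrite lerDl ltW.
  by rewrite leNgt lr.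
have [l' ll' tl'] := distf_rcont mf t0 td.
apply: (@lt_le_trans _ _ l'%:E); first by rewrite lte_fin.
apply: le_ereal_inf_tmp => _ [m [m0 mt] <-].
rewrite lee_fin leNgt; apply/negP => ml'.
have := le_lt_trans (le_trans (distf_le mf (ltW ml')) mt) tl'.
by rewrite ltxx.
Qed.

(* The functions on [0, +oo[ that are equal to their own rearrangement. *)
Record rearranged g : Prop := {
  rearranged_ge0 : forall t, 0 <= t -> (0 <= g t)%E;
  rearranged_le : forall s t, 0 <= s -> s <= t -> (g t <= g s)%E;
  rearranged_out : forall t, 0 <= t -> ~ I t -> g t = 0%E;
  rearranged_rcont : forall t l, 0 <= t -> 0 <= l -> (l%:E < g t)%E ->
    exists2 s, t < s & (l%:E < g s)%E }.

(** Superlevel sets of a monotone function on the half-line are intervals; [D] itself may be no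
    interval, hence the restriction at the end. *)
Lemma nonincreasing_measurable_fun (D : set R) g : measurable D ->
  (forall s, D s -> 0 <= s) ->
  (forall s t, 0 <= s -> s <= t -> (g t <= g s)%E) -> measurable_fun D g.
Proof.
move=> mD D0 ng.
have mg : measurable_fun (`[0%R, +oo[%classic : set R) g.
  move=> m0; apply: (measurability _ (ErealGenOInfty.measurableE R)) => // _ [_ [x ->] <-].
  apply: is_interval_measurable => s t [] /=.
  rewrite !in_itv/= !andbT => s0 gs [t0 gt] u /andP[su ut]; split.
    by rewrite /= in_itv/= andbT (le_trans s0).
  by rewrite /= in_itv/= andbT (lt_le_trans gt)// ng// (le_trans s0).
apply: measurable_funS mg => //.
by move=> s /D0 s0; rewrite /= in_itv/= s0.
Qed.

Lemma rearranged_measurable (D : set R) g : measurable D ->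
  (forall s, D s -> 0 <= s) -> rearranged g -> measurable_fun D g.
Proof.
move=> mD D0 dg; apply: nonincreasing_measurable_fun => //.
exact: rearranged_le.
Qed.

Lemma rearr_rearranged f : measurable_fun I f -> rearranged (rearr I f).
Proof.
move=> mf; split.
- by move=> t _; exact: rearr_ge0.
- by move=> s t _; exact: rearr_le.
- move=> t t0 It; apply/eqP; rewrite eq_le rearr_ge0 andbT leNgt lt_rearr//.
  rewrite -leNgt (le_trans _ (domain_mu_le t0 It))//.
  apply: le_measure; rewrite ?inE; [exact: distf_measurable|exact: domain_measurable|].
  by move=> s [].
- move=> t l t0 l0; rewrite lt_rearr// => tl.
  have [q tq ql] := @ereal_rat_between t%:E _ t0 tl.
  rewrite lte_fin in tq; exists (ratr q) => //.
  by rewrite lt_rearr// (le_trans t0)// ltW.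
Qed.

(** For [l >= 0] the superlevel set of the rearrangement is the interval from 0 of length
    [distf I f l], or all of [I] when that value is infinite. *)
Lemma distf_rearr f : measurable_fun I f -> distf I (rearr I f) = distf I f.
Proof.
move=> mf; apply/funext => l.
have [l0|l0] := ltP l 0.
  rewrite /distf; congr mu; apply/seteqP; split => s [Is _]; split => //=;
  by apply: lt_le_trans (abse_ge0 _); rewrite lte_fin.
rewrite [LHS]/distf.
have -> : I `&` [set s | l%:E < `|rearr I f s|]%E =
          I `&` [set s | s%:E < distf I f l]%E.
  apply/seteqP; split => s [Is /= H]; split => //=.
    by rewrite -lt_rearr// ?(domain_ge0 Is)// -(gee0_abs (rearr_ge0 _ _)).
  by rewrite (gee0_abs (rearr_ge0 _ _)) lt_rearr// (domain_ge0 Is).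
have dI : (distf I f l <= mu I)%E.
  apply: le_measure; rewrite ?inE; [exact: distf_measurable|exact: domain_measurable|].
  by move=> s [].
have d0 : (0 <= distf I f l)%E by exact: measure_ge0.
case E : (distf I f l) => [c| |]; move: dI d0; rewrite E //= => dI d0.
  have -> : I `&` [set s | s%:E < c%:E]%E = `[0%R, c[%classic.
    apply/seteqP; split => s /=.
      by move=> [Is]; rewrite lte_fin in_itv/= (domain_ge0 Is).
    rewrite in_itv/= lte_fin => /andP[s0 sc]; split => //.
    apply: contrapT => /(domain_mu_le s0) /(le_trans dI).
    by rewrite lee_fin leNgt sc.
  rewrite lebesgue_measure_itv/= lte_fin; case: ltP => [_|c0].
    by rewrite sube0.
  by congr EFin; apply/eqP; rewrite eq_le c0 -lee_fin d0.
have -> : I `&` [set s | s%:E < +oo]%E = I.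
  by apply/seteqP; split => [s []//|s Is]; split => //=; rewrite ltry.
by apply/eqP; rewrite -leye_eq.
Qed.

(** If [g t < l], the superlevel set of [g] at [l] lies in [0, t[, so its measure is at most [t]. *)
Lemma rearr_le_nonincreasing g t : 
  (forall t, 0 <= t -> (0 <= g t)%E) ->
  (forall s t, 0 <= s -> s <= t -> (g t <= g s)%E) ->
  0 <= t -> (rearr I g t <= g t)%E.
Proof.
move=> g0 ng t0.
have mg : measurable_fun I g.
  by apply: nonincreasing_measurable_fun => //; [exact: domain_measurable|exact: domain_ge0].
apply: lee_of_lt; first exact: g0.
move=> l l0; rewrite lt_rearr// => tl; rewrite leNgt; apply/negP => gl.
have : (distf I g l <= mu (`[0%R, t[%classic : set R))%E.
  apply: le_measure; rewrite ?inE; [exact: distf_measurable|exact: measurable_itv|].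
  move=> s [Is /=]; have s0 := domain_ge0 Is.
  rewrite gee0_abs ?g0// => ls; rewrite in_itv/= s0/= ltNge; apply/negP => ts.
  by have := lt_le_trans (lt_trans gl ls) (ng _ _ t0 ts); rewrite ltxx.
rewrite lebesgue_measure_itv/= lte_fin => H.
have := lt_le_trans tl H; case: ifPn => _; first by rewrite sube0 ltxx.
by rewrite lte_fin ltNge t0.
Qed.

(** If [l < g s], the superlevel set at [l] contains [0, s[, of measure greater than [t]. The strict
    [t < s] makes up for the missing right-continuity of [g]. *)
Lemma nonincreasing_le_rearr g s t :
  (forall t, 0 <= t -> (0 <= g t)%E) ->
  (forall s t, 0 <= s -> s <= t -> (g t <= g s)%E) ->
  (forall t, 0 <= t -> ~ I t -> g t = 0%E) ->
  0 <= t -> t < s -> (g s <= rearr I g t)%E.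
Proof.
move=> g0 ng gI t0 ts.
have mg : measurable_fun I g.
  by apply: nonincreasing_measurable_fun => //; [exact: domain_measurable|exact: domain_ge0].
apply: lee_of_lt; first exact: rearr_ge0.
move=> l l0 lgs; apply: ltW; rewrite lt_rearr//.
have s0 : 0 <= s by rewrite (le_trans t0)// ltW.
have Is : I s.
  apply: contrapT => /(gI _ s0) gs0; move: lgs.
  by rewrite gs0 lte_fin ltNge l0.
apply: (@lt_le_trans _ _ (mu (`[0%R, s[%classic : set R))).
  by rewrite lebesgue_measure_itv/= lte_fin (le_lt_trans t0 ts) sube0.
apply: le_measure; rewrite ?inE; [exact: measurable_itv|exact: distf_measurable|].
move=> u; rewrite /= in_itv/= => /andP[u0 us]; split.
  exact: (domain_down u0 (ltW us)).
by rewrite /= gee0_abs ?g0// (lt_le_trans lgs)// ng// ltW.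
Qed.

Lemma rearrangedE g t : rearranged g -> 0 <= t -> rearr I g t = g t.
Proof.
move=> [g0 ng gI gr] t0; apply/eqP; rewrite eq_le rearr_le_nonincreasing//=.
apply: lee_of_lt; first exact: rearr_ge0.
move=> l l0 /(gr _ _ t0 l0)[s ts ls].
by rewrite (le_trans (ltW ls))// nonincreasing_le_rearr.
Qed.

(* Each rational separates the two functions at no more than one point. *)
Lemma rearr_ae_nonincreasing g :
  (forall t, 0 <= t -> (0 <= g t)%E) ->
  (forall s t, 0 <= s -> s <= t -> (g t <= g s)%E) ->
  (forall t, 0 <= t -> ~ I t -> g t = 0%E) ->
  eqL0 I g (rearr I g).
Proof.
move=> g0 ng gI.
pose N (q : rat) := [set s | [/\ I s, (rearr I g s < (ratr q)%:E)%E &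
   ((ratr q)%:E < g s)%E]].
have cN : countable (\bigcup_(q in setT) N q).
  apply: bigcup_countable => [|q _]; first exact: countableP.
  apply: (@sub_countable _ _ _ [set xget 0 (N q)]); last exact: countable1.
  apply: subset_card_le => s Ns.
  have Nx : N q (xget 0 (N q)) by apply: xgetI Ns.
  have H u v : N q u -> N q v -> u <= v.
    move=> [Iu _ qu] [Iv vq _]; rewrite leNgt; apply/negP => vu.
    have := nonincreasing_le_rearr g0 ng gI (domain_ge0 Iv) vu.
    by rewrite leNgt (lt_trans vq qu).
  by apply/eqP; rewrite eq_le !H.
exists (\bigcup_(q in setT) N q); split.
- exact: countable_measurable.
- exact: countable_lebesgue_measure0.
- move=> s /= /not_implyP[Is gs].
  have s0 := domain_ge0 Is.
  have := rearr_le_nonincreasing g0 ng s0.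
  rewrite le_eqVlt => /predU1P[E|]; first by rewrite E in gs.
  by move=> /(ereal_rat_between (rearr_ge0 _ _))[q ? ?]; exists q.
Qed.

End Profiles.

(** * The cone of decreasing elements *)

Section Closure.
Context {R : realType} (I : set R).
Implicit Types (g h : R -> \bar R) (s t l : R).

Lemma rearranged0 : rearranged I (cst 0%E : R -> \bar R).
Proof.
split => // t l t0 l0.
by rewrite lte_fin => /(le_lt_trans l0); rewrite ltxx.
Qed.

(** Frees right-continuity from the condition [0 <= l]: the levels [a - e / 2] in [rearrangedD] may
    be negative. *)
Lemma rearranged_gt g t l : rearranged I g -> 0 <= t -> (l%:E < g t)%E ->
  exists2 s, t < s & (l%:E < g s)%E.
Proof.
move=> [g0 ng gI gr] t0 lg; have [l0|l0] := leP 0 l; first exact: gr.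
exists (t + 1); first by rewrite ltrDl.
by apply: (@lt_le_trans _ _ 0%E); rewrite ?lte_fin// g0// addr_ge0.
Qed.

Lemma rearrangedD g h : rearranged I g -> rearranged I h ->
  rearranged I (fun t => g t + h t)%E.
Proof.
move=> dg dh; have [g0 ng gI gr] := dg; have [h0 nh hI hr] := dh; split.
- by move=> t t0; rewrite adde_ge0// ?g0 ?h0.
- by move=> s t s0 st; rewrite leeD// ?ng ?nh.
- by move=> t t0 It; rewrite gI// hI// adde0.
- move=> t l t0 l0.
  have := g0 t t0; have := h0 t t0.
  case Eg : (g t) => [a| |] //; case Eh : (h t) => [b| |] // _ _.
  (* Both values are finite: each summand loses less than half of the excess [e] at some point to
     the right of [t]. *)
  + rewrite lte_fin -subr_gt0 => lab.
    set e := a + b - l in lab.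
    have e2 : 0 < e / 2 by rewrite divr_gt0.
    have [s1 ts1 as1] : exists2 s, t < s & ((a - e / 2)%:E < g s)%E.
      by apply: rearranged_gt; rewrite // Eg lte_fin gtrBl.
    have [s2 ts2 bs2] : exists2 s, t < s & ((b - e / 2)%:E < h s)%E.
      by apply: rearranged_gt; rewrite // Eh lte_fin gtrBl.
    exists (Num.min s1 s2); first by rewrite lt_min ts1.
    have s0 : 0 <= Num.min s1 s2 by rewrite le_min !(le_trans t0)// ltW.
    have -> : l = (a - e / 2) + (b - e / 2).
      by rewrite addrACA -opprD -splitr /e opprB addrC subrK.
    rewrite EFinD lteD//.
      by rewrite (lt_le_trans as1)// ng// ge_min lexx.
    by rewrite (lt_le_trans bs2)// nh// ge_min lexx orbT.
  (* An infinite summand exceeds [l] to the right of [t] by itself, the other one being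
     nonnegative. *)
  + move=> _; have [|s ts ls] := hr t l t0 l0; first by rewrite Eh ltry.
    by exists s => //; rewrite (lt_le_trans ls)// leeDr// g0// (le_trans t0)// ltW.
  + move=> _; have [|s ts ls] := gr t l t0 l0; first by rewrite Eg ltry.
    by exists s => //; rewrite (lt_le_trans ls)// leeDl// h0// (le_trans t0)// ltW.
  + move=> _; have [|s ts ls] := gr t l t0 l0; first by rewrite Eg ltry.
    by exists s => //; rewrite (lt_le_trans ls)// leeDl// h0// (le_trans t0)// ltW.
Qed.

Lemma rearrangedZ (c : R) g : 0 < c -> rearranged I g ->
  rearranged I (fun t => c%:E * g t)%E.
Proof.
move=> c0 [g0 ng gI gr]; split.
- by move=> t t0; rewrite mule_ge0 ?g0// lee_fin ltW.
- by move=> s t s0 st; rewrite lee_pmul2l// ?ng// lte_fin.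
- by move=> t t0 It; rewrite gI// mule0.
- move=> t l t0 l0.
  have H s : (l%:E < c%:E * g s)%E = ((c^-1 * l)%:E < g s)%E.
    have -> : l%:E = (c%:E * (c^-1 * l)%:E)%E by rewrite -EFinM mulVKf// gt_eqF.
    by rewrite lte_pmul2l// lte_fin.
  rewrite H => /gr[||s ts] //; first by rewrite mulr_ge0// invr_ge0 ltW.
  by rewrite -H; exists s.
Qed.

(** For nonincreasing functions right-continuity is lower semicontinuity, which passes to suprema: a
    level below the supremum is already exceeded by one [g n]. *)
Lemma rearranged_sup (g : nat -> R -> \bar R) : (forall n, rearranged I (g n)) ->
  rearranged I (fun t => ereal_sup (range (g ^~ t))).
Proof.
move=> dg; split.
- move=> t t0; apply: le_ereal_sup_tmp; exists (g 0%N t); first by exists 0%N.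
  by case: (dg 0%N) => g0 _ _ _; exact: g0.
- move=> s t s0 st; apply: ge_ereal_sup => _ [n _ <-].
  apply: le_ereal_sup_tmp; exists (g n s); first by exists n.
  by case: (dg n) => _ ng _ _; exact: ng.
- move=> t t0 It; have -> : range (g ^~ t) = [set 0%E]; last by rewrite ereal_sup1.
  apply/seteqP; split => [_ [n _ <-]|_ ->]; last exists 0%N => //;
  by [case: (dg n) => _ _ gI _; exact: gI|case: (dg 0%N) => _ _ gI _; exact: gI].
- move=> t l t0 l0 /ereal_sup_gt[_ [n _ <-] lg].
  have [_ _ _ /(_ _ _ t0 l0 lg)[s ts ls]] := dg n.
  exists s => //; apply: lt_le_trans ls _.
  by apply: ereal_sup_ubound; exists n.
Qed.

End Closure.

(** * The K-functional and the domination order on the cone *)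

Section Cone.
Context {R : realType} (I : set R).
Hypothesis hI : I = `[0%R, 1%R[%classic \/ I = `[0%R, +oo[%classic.
Context {E : completeNormedModType R} (iota : E -> R -> \bar R).
Hypothesis hE : banach_function_space I iota.
Local Notation mu := (@lebesgue_measure R).
Local Notation D := (decreasing_cone I iota).
Implicit Types (e f : E) (g h : R -> \bar R) (s t l : R).

(** The K-functional of the couple formed by L^1 and L^infinity; for [t > 0] it is [t] times
    [mrearr]. *)
Definition Kfunctional e t : \bar R :=
  (\int[mu]_(s in `[0%R, t]) rearr I (iota e) s)%E.
Local Notation J := Kfunctional.

(** Since [rearr] depends only on the class and fixes [g], an almost everywhere identity becomes a
    pointwise one. Rearrangements of sums, multiples and suprema are computed this way. *)
Lemma cone_of_rearranged e g : rearranged I g -> eqL0 I (iota e) g ->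
  D e /\ forall t, 0 <= t -> rearr I (iota e) t = g t.
Proof.
move=> dg eg.
have mg : measurable_fun I g.
  exact: (rearranged_measurable (domain_measurable hI) (@domain_ge0 _ _ hI) dg).
have H t : 0 <= t -> rearr I (iota e) t = g t.
  move=> t0; rewrite -(rearrangedE hI dg t0).
  by rewrite /rearr (distf_ae hI (bfs_measurable hE e) mg eg).
split => //; exists e; apply: eqL0_trans eg _.
by apply: aeW => s Is; rewrite H// (domain_ge0 hI).
Qed.

Lemma coneE e : D e -> eqL0 I (iota e) (rearr I (iota e)).
Proof.
move=> [f ef].
have [_ H] := cone_of_rearranged (rearr_rearranged hI (bfs_measurable hE f)) ef.
by apply: eqL0_trans ef _; apply: aeW => s Is; rewrite H// (domain_ge0 hI).
Qed.

Lemma cone_rearranged e : rearranged I (rearr I (iota e)).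
Proof. exact: (rearr_rearranged hI (bfs_measurable hE e)). Qed.

Lemma iota0 : eqL0 I (iota 0) (cst 0%E).
Proof.
have := bfs_scale hE 0 0; rewrite scale0r => h.
by apply: eqL0_trans h _; apply: aeW => s _; rewrite mul0e.
Qed.

Lemma cone0 : D 0 /\ forall t, 0 <= t -> rearr I (iota 0) t = 0%E.
Proof. exact: (cone_of_rearranged (rearranged0 I) iota0). Qed.

Lemma coneD e f : D e -> D f -> D (e + f) /\ forall t, 0 <= t ->
  rearr I (iota (e + f)) t = (rearr I (iota e) t + rearr I (iota f) t)%E.
Proof.
move=> De Df.
apply: (cone_of_rearranged (rearrangedD (cone_rearranged e) (cone_rearranged f))).
apply: eqL0_trans (bfs_add hE e f) _.
by apply: ae_mono2 (coneE De) (coneE Df) => s He Hf Is; rewrite He// Hf.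
Qed.

Lemma coneZ (c : R) e : 0 < c -> D e -> D (c *: e) /\ forall t, 0 <= t ->
  rearr I (iota (c *: e)) t = (c%:E * rearr I (iota e) t)%E.
Proof.
move=> c0 De.
apply: (cone_of_rearranged (rearrangedZ c0 (cone_rearranged e))).
apply: eqL0_trans (bfs_scale hE c e) _.
by apply: ae_mono (coneE De) => s He Is; rewrite He.
Qed.

Lemma segment_ge0 t s : (`[0%R, t]%classic : set R) s -> 0 <= s.
Proof. by rewrite /= in_itv/= => /andP[]. Qed.

Lemma rearr_measurable e t :
  measurable_fun (`[0%R, t]%classic : set R) (rearr I (iota e)).
Proof.
apply: (rearranged_measurable _ _ (cone_rearranged e)); first exact: measurable_itv.
exact: segment_ge0.
Qed.

Lemma Kfunctional_ge0 e t : (0 <= J e t)%E.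
Proof. by apply: integral_ge0 => s _; exact: rearr_ge0. Qed.

Lemma KprecE e f : Kprec I (iota e) (iota f) <->
  forall t, 0 < t -> (J e t <= J f t)%E.
Proof.
by split => H t t0; have := H t t0; rewrite /mrearr lee_pmul2l// lte_fin invr_gt0.
Qed.

Lemma Kfunctional_eq e g t : (forall s, 0 <= s -> rearr I (iota e) s = g s) ->
  J e t = (\int[mu]_(s in `[0%R, t]) g s)%E.
Proof.
by move=> H; rewrite /J; apply: eq_integral => s /set_mem /segment_ge0 s0; rewrite H.
Qed.

Lemma Kfunctional_add e f t : D e -> D f -> J (e + f) t = (J e t + J f t)%E.
Proof.
move=> De Df; rewrite (Kfunctional_eq _ (coneD De Df).2) ge0_integralD//.
- by move=> s _; exact: rearr_ge0.
- exact: rearr_measurable.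
- by move=> s _; exact: rearr_ge0.
- exact: rearr_measurable.
Qed.

Lemma Kfunctional_scale (c : R) e t : 0 < c -> D e -> J (c *: e) t = (c%:E * J e t)%E.
Proof.
move=> c0 De; rewrite (Kfunctional_eq _ (coneZ c0 De).2) ge0_integralZl_EFin//.
- by move=> s _; exact: rearr_ge0.
- exact: rearr_measurable.
- exact: ltW.
Qed.

(** Membership in the cone is included because [Kfunctional] is additive there, while in general it
    is only subadditive; this lets the relation pass to sums. *)
Definition Kle e f := [/\ D e, D f & forall t, 0 < t -> (J e t <= J f t)%E].

Lemma Kle_refl e : D e -> Kle e e. Proof. by split. Qed.

Lemma Kle_add e f e' f' : Kle e f -> Kle e' f' -> Kle (e + e') (f + f').
Proof.
move=> [De Df ef] [De' Df' ef']; split.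
- exact: (coneD De De').1.
- exact: (coneD Df Df').1.
- move=> t t0; rewrite (Kfunctional_add t De De').
  by rewrite (Kfunctional_add t Df Df'); apply: leeD; [exact: ef|exact: ef'].
Qed.

Lemma Kle_scale (c : R) e f : 0 < c -> Kle e f -> Kle (c *: e) (c *: f).
Proof.
move=> c0 [De Df ef]; split.
- exact: (coneZ c0 De).1.
- exact: (coneZ c0 Df).1.
- move=> t t0; rewrite (Kfunctional_scale t c0 De).
  rewrite (Kfunctional_scale t c0 Df); apply: lee_wpmul2l; last exact: ef.
  by rewrite lee_fin ltW.
Qed.

Lemma Kle_sum (I' : Type) (r : seq I') (P : pred I') (e f : I' -> E) :
  (forall i, P i -> Kle (e i) (f i)) ->
  Kle (\sum_(i <- r | P i) e i) (\sum_(i <- r | P i) f i).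
Proof.
move=> H; elim/big_ind2: _.
- by apply: Kle_refl; exact: cone0.1.
- move=> x1 x2 y1 y2; exact: Kle_add.
- exact: H.
Qed.

Lemma cone_inj e f : D e -> D f ->
  eqL0 I (rearr I (iota e)) (rearr I (iota f)) -> e = f.
Proof.
move=> De Df ef; apply: (bfs_inj hE).
apply: eqL0_trans (coneE De) _; apply: eqL0_trans ef _.
exact/eqL0_sym/coneE.
Qed.

Hypothesis hSKM : strictly_Kmonotone_on I iota D.

Lemma Kle_norm e f : Kle e f -> `|e| <= `|f|.
Proof.
move=> [De Df ef].
have ef' : Kprec I (iota e) (iota f) by exact/KprecE.
have [/(cone_inj De Df) -> //|nef] :=
  pselect (eqL0 I (rearr I (iota e)) (rearr I (iota f))).
exact: (ltW (hSKM De Df ef' nef)).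
Qed.

Lemma Kle_norm_eq e f : Kle e f -> `|e| = `|f| -> e = f.
Proof.
move=> [De Df ef] nef; apply: (cone_inj De Df).
have ef' : Kprec I (iota e) (iota f) by exact/KprecE.
apply: contrapT => H.
by have := hSKM De Df ef' H; rewrite nef ltxx.
Qed.

(** An infinite value at [t] would by monotonicity be taken on all of [0, t[, a set of positive
    measure, whereas elements of the space are finite almost everywhere. *)
Lemma rearr_lty e t : D e -> 0 < t -> (rearr I (iota e) t < +oo)%E.
Proof.
move=> De t0.
have [It|It] := pselect (I t); last first.
  by have [_ _ -> //] := cone_rearranged e; rewrite ?ltry// ltW.
rewrite ltNge leye_eq; apply/negP => /eqP ry.
have fin : {ae mu, forall s, I s -> rearr I (iota e) s \is a fin_num}.
  by apply: ae_mono2 (coneE De) (bfs_fin hE e) => s He Hf Is; rewrite -He// Hf.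
have [N [mN N0 NI]] := fin.
have : (mu (`[0%R, t[%classic : set R) <= mu N)%E.
  apply: le_measure; rewrite ?inE//.
  move=> s; rewrite /= in_itv/= => /andP[s0 st]; apply/NI => /= H.
  have := H (domain_down hI s0 (ltW st) It).
  rewrite (_ : rearr I (iota e) s = +oo%E)//.
  by apply/eqP; rewrite -leye_eq -ry rearr_le// ltW.
by rewrite N0 lebesgue_measure_itv/= lte_fin t0 sube0 lee_fin leNgt t0.
Qed.

(* If the integral were infinite for some [t] it would be so for every [t], so
   that [2 *: e] would be dominated by [e]. *)
Lemma Kfunctional_lty e t : D e -> 0 < t -> (J e t < +oo)%E.
Proof.
move=> De t0; rewrite ltNge leye_eq; apply/negP => /eqP Jy.
have Jall t' : 0 < t' -> J e t' = +oo%E.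
  move=> t'0; apply/eqP; rewrite -leye_eq -Jy.
  have [tt'|t't] := leP t t'.
    apply: ge0_subset_integral => //; first exact: rearr_measurable.
      by move=> s _; exact: rearr_ge0.
    move=> s; rewrite /= !in_itv/= => /andP[-> st]; exact: le_trans st tt'.
  rewrite Jy leye_eq; apply/eqP.
  have Jsplit : (J e t = J e t' + \int[mu]_(s in `]t', t]) rearr I (iota e) s)%E.
    rewrite /J -ge0_integral_setU//=.
    - congr integral; apply/seteqP; split => s; rewrite /= !in_itv/=.
        by move=> /andP[s0 st]; case: (leP s t') => st'; [left|right]; apply/andP.
      move=> [/andP[-> st']|/andP[st' ->]]; first by rewrite (le_trans st')// ltW.
      by rewrite (le_trans (ltW t'0))// ltW.
    - apply: (rearranged_measurable _ _ (cone_rearranged e)).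
        by apply: measurableU; exact: measurable_itv.
      by move=> s [/segment_ge0//|]; rewrite /= in_itv/= => /andP[/ltW + _]; exact/le_trans/ltW.
    - by move=> s _; exact: rearr_ge0.
    - apply/disj_setPS => s []; rewrite /= !in_itv/= => /andP[_ st'] /andP[].
      by rewrite ltNge st'.
  (* Away from 0 the integrand is bounded by its finite value at [t'], so the divergence comes from
     [0, t']. *)
  have : (\int[mu]_(s in `]t', t]) rearr I (iota e) s < +oo)%E.
    apply: (@le_lt_trans _ _ (\int[mu]_(s in `]t', t]) cst (rearr I (iota e) t') s)%E).
      apply: ge0_le_integral => //.
      - by move=> s _; exact: rearr_ge0.
      - apply: (rearranged_measurable _ _ (cone_rearranged e)) => //.
        by move=> s; rewrite /= in_itv/= => /andP[/ltW + _]; exact/le_trans/ltW.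
      - by move=> s; rewrite /= in_itv/= => /andP[/ltW + _]; exact: rearr_le.
    rewrite integral_cst//.
    have := rearr_lty De t'0; have := rearr_ge0 I (iota e) t'.
    case: (rearr I (iota e) t') => // r _ _.
    by rewrite /= lebesgue_measure_itv/= lte_fin t't -EFinB -EFinM ltry.
  move: Jsplit; rewrite Jy.
  case: (J e t') (Kfunctional_ge0 e t') => // r _.
  by case: (integral _ _ _) => //.
have e2 : Kle (2 *: e) e.
  split; [exact: (coneZ _ De).1|exact: De|].
  by move=> t' t'0; rewrite (Jall t' t'0) leey.
(* Twice the norm of [e] is at most the norm of [e], so [e = 0], whose integral is not infinite. *)
have := Kle_norm e2; rewrite normrZ ger0_norm// mulr2n mulrDl mul1r gerDl.
rewrite normr_le0 => /eqP e0.
by have := Jy; rewrite e0 (Kfunctional_eq t cone0.2) integral0.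
Qed.

End Cone.

(** * Limits of decreasing elements *)

Section Limits.
Context {R : realType}.
Implicit Types (v d : nat -> \bar R) (p : \bar R).

Lemma limn_esup_ge0 v : (forall n, 0 <= v n)%E -> (0 <= limn_esup v)%E.
Proof.
move=> v0; rewrite limn_esup_lim; apply: lime_ge; first exact: is_cvg_esups.
apply: nearW => n; apply: le_ereal_sup_tmp; exists (v n) => //.
by exists n => /=.
Qed.

Lemma le_limn_esup v d : (forall n, v n <= d n)%E ->
  (limn_esup v <= limn_esup d)%E.
Proof.
move=> vd; rewrite !limn_esup_lim; apply: lee_lim; try exact: is_cvg_esups.
apply: nearW => n; apply: ge_ereal_sup => _ [m /= nm <-].
by apply: le_ereal_sup_tmp; exists (d m) => //; exists m.
Qed.

Lemma le_nneseries_term (d : nat -> \bar R) n : (forall k, 0 <= d k)%E ->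
  (d n <= \sum_(n <= k <oo) d k)%E.
Proof.
move=> d0; have := @nneseries_lim_ge _ d xpredT n n.+1 (fun k _ _ => d0 k).
by rewrite big_nat1.
Qed.

(** Each [|d n|] is below the tail of a convergent series. The hypothesis reads [v n = d n + p],
    avoiding extended real subtraction; [d] will be the class of a difference taken in the space. *)
Lemma cvg_of_summable v d p : p \is a fin_num ->
  (\sum_(0 <= k <oo) `|d k| < +oo)%E -> (forall n, v n = d n + p)%E ->
  v @ \oo --> p.
Proof.
move=> pf dy vE.
have d0 : d @ \oo --> 0%E.
  apply/cvg_abse0P.
  have := nneseries_tail_cvg dy (fun k _ => abse_ge0 (d k)) => tl.
  apply: (@squeeze_cvge _ _ _ _ (cst 0%E) _ _ _ _ (cvg_cst _) tl).
  apply: nearW => n; rewrite abse_ge0/=.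
  by apply: (@le_nneseries_term (fun k => `|d k|)%E) => k.
have -> : v = (fun n => d n + p)%E by apply/funext.
rewrite -[X in _ --> X]add0e; apply: cvgeD => //; last exact: cvg_cst.
Qed.

Lemma le_of_summable v d p n : (forall n, v n = d n + p)%E ->
  (`|v n| <= `|p| + \sum_(0 <= k <oo) `|d k|)%E.
Proof.
move=> vE; rewrite vE (le_trans (lee_abs_add _ _))// addeC leeD2l//.
apply: le_trans (nneseries_lim_ge n.+1 (fun k _ _ => abse_ge0 (d k))).
by rewrite big_nat_recr//= leeDr// sume_ge0.
Qed.

End Limits.

(** * Limits in the cone of sequences with geometric rate *)

Section ConeLimit.
Context {R : realType} (I : set R).
Hypothesis hI : I = `[0%R, 1%R[%classic \/ I = `[0%R, +oo[%classic.
Context {E : completeNormedModType R} (iota : E -> R -> \bar R).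
Hypothesis hE : banach_function_space I iota.
Hypothesis hFatou : fatou_property I iota.
Local Notation mu := (@lebesgue_measure R).
Local Notation D := (decreasing_cone I iota).
Hypothesis hSKM : strictly_Kmonotone_on I iota D.
Local Notation J := (Kfunctional I iota).
Implicit Types (e f p : E) (g h : R -> \bar R) (s t l : R).

Lemma bfs_abs e : exists2 f, eqL0 I (iota f) (fun s => `|iota e s|)%E & `|f| <= `|e|.
Proof.
apply: (bfs_ideal hE).
  exact: (measurableT_comp _ (bfs_measurable hE e)).
by apply: aeW => s _; rewrite abse_id.
Qed.

(* Riesz-Fischer *)
Lemma bfs_summable (d : nat -> E) : (forall j, `|d j| <= 2^-1 ^+ j) ->
  exists S, eqL0 I (iota S) (fun s => \sum_(0 <= j <oo) `|iota (d j) s|)%E.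
Proof.
move=> dle.
have /choice[a /all_and2[aE aN]] : forall j, exists f,
    eqL0 I (iota f) (fun s => `|iota (d j) s|)%E /\ `|f| <= `|d j|.
  by move=> j; have [f] := bfs_abs (d j); exists f.
pose X n := \sum_(0 <= j < n) a j.
have XE n : eqL0 I (iota (X n)) (fun s => \sum_(0 <= j < n) `|iota (d j) s|)%E.
  elim: n => [|n IH].
    rewrite /X big_geq//; apply: eqL0_trans (iota0 hE) _.
    by apply: aeW => s _; rewrite big_geq.
  rewrite /X big_nat_recr//=; apply: eqL0_trans (bfs_add hE _ _) _.
  apply: ae_mono2 IH (aE n) => s IH aEn Is.
  by rewrite big_nat_recr//= -IH// -aEn.
have Xall : {ae mu, forall s n, I s -> iota (X n) s = \sum_(0 <= j < n) `|iota (d j) s|}%E.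
  exact: ae_foralln.
have [||||S [SE _ _]] := hFatou (x_ := X) (x := fun s => \sum_(0 <= j <oo) `|iota (d j) s|)%E.
- apply: (@ge0_emeasurable_sum _ _ _ _ (fun j s => `|iota (d j) s|)%E xpredT) => // j _.
  exact: (measurableT_comp _ (bfs_measurable hE _)).
- move=> n; apply: ae_mono (XE n) => s XEn Is.
  by rewrite XEn//= sume_ge0.
- exists 2 => _ [n _ <-].
  (* The right-hand side is the partial geometric sum, which carries the induction where the bound 2
     would not. *)
  have : `|X n| <= 2 - 2 * 2^-1 ^+ n.
    elim: n => [|n IH]; first by rewrite /X big_geq// normr0 expr0 mulr1 subrr.
    rewrite /X big_nat_recr//= (le_trans (ler_normD _ _))//.
    rewrite (le_trans (lerD IH (le_trans (aN n) (dle n))))//.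
    rewrite exprS mulrA divff// mul1r mulr2n mulrDl mul1r opprD.
    by rewrite -!addrA addNr addr0.
  by move/le_trans; apply; rewrite gerBl mulr_ge0// exprn_ge0// invr_ge0.
- apply: ae_mono Xall => s Xs Is; split.
    move=> m n mn; rewrite !Xs//.
    exact: (ereal_nondecreasing_series (fun k _ _ => abse_ge0 (iota (d k) s))).
  have -> : (fun n => iota (X n) s) = (fun n => \sum_(0 <= j < n) `|iota (d j) s|)%E.
    by apply/funext => n; rewrite Xs.
  exact: (is_cvg_nneseries (fun k _ _ => abse_ge0 (iota (d k) s))).
- by exists S.
Qed.

Lemma bfs_sub e f : {ae mu, forall s, I s -> [/\ iota f s \is a fin_num &
  iota e s = (iota (e - f)%R s + iota f s)%E]}.
Proof.
have := bfs_add hE (e - f) f; rewrite subrK => H.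
by apply: ae_mono2 H (bfs_fin hE f) => s H1 H2 Is; split; [exact: H2|exact: H1].
Qed.

(** The rate makes the differences summable, which gives both almost everywhere convergence and one
    decreasing majorant; dominated convergence then carries the K-functionals to the limit. *)
Lemma cone_fast_limit (w : nat -> E) p : (forall j, D (w j)) ->
  (forall j, `|w j - p| <= 2^-1 ^+ j) ->
  D p /\ forall t, 0 < t -> J (w j) t @[j --> \oo] --> J p t.
Proof.
move=> Dw wp; pose h j := rearr I (iota (w j)).
have dh j : rearranged I (h j) by exact: cone_rearranged.
have [S SE] := bfs_summable wp.
have H : {ae mu, forall s, I s -> [/\ iota p s \is a fin_num,
   iota S s = (\sum_(0 <= j <oo) `|iota (w j - p)%R s|)%E, iota S s \is a fin_num &
   forall j, h j s = (iota (w j - p)%R s + iota p s)%E]}.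
  have H1 : {ae mu, forall s j, I s -> iota p s \is a fin_num /\
      h j s = (iota (w j - p)%R s + iota p s)%E}.
    apply: ae_foralln => j.
    by apply: ae_mono2 (bfs_sub (w j) p) (coneE hI hE (Dw j)) => s K1 K2 Is;
      have [pf E1] := K1 Is; split; rewrite // /h -K2.
  have H2 := ae_mono2 (fun s => @conj _ _) SE (bfs_fin hE S).
  apply: ae_mono2 H1 H2 => s K1 [K2 K3] Is; split; [|exact: K2|exact: K3|].
    by have [] := K1 0%N Is.
  by move=> j; have [] := K1 j Is.
have hcvg : {ae mu, forall s, I s -> h j s @[j --> \oo] --> iota p s}.
  apply: ae_mono H => s /[apply] -[pf SEs Sf hs].
  by apply: (cvg_of_summable pf _ hs); rewrite -SEs ltey_eq Sf.
(* [|p| + S] is in the space but need not be decreasing, whereas local integrability is known on the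
   cone. The supremum is decreasing and almost everywhere below it. *)
pose G s := ereal_sup (range (h ^~ s)).
have dG : rearranged I G by exact: rearranged_sup.
have mG : measurable_fun I G.
  exact: (rearranged_measurable (domain_measurable hI) (@domain_ge0 _ _ hI) dG).
have [e eG] : exists e, eqL0 I (iota e) G.
  have [pa paE _] := bfs_abs p.
  have [||e eG _] := @bfs_ideal _ _ _ _ hE G (pa + S); [exact: mG| |by exists e].
  have H2 := ae_mono2 (fun s => @conj _ _) paE (bfs_add hE pa S).
  apply: ae_mono2 H H2 => s K1 [K2 K3] Is; have [pf SEs Sf hs] := K1 Is.
  rewrite K3// K2// SEs.
  have G0 : (0 <= G s)%E by apply: (rearranged_ge0 dG); exact: domain_ge0 Is.
  rewrite gee0_abs// [leRHS]gee0_abs; last by rewrite adde_ge0// nneseries_ge0.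
  apply: ge_ereal_sup => _ [j _ <-].
  exact: (le_trans (lee_abs _) (le_of_summable j hs)).
have [De rG] := cone_of_rearranged hI hE dG eG.
(* The limit exists only almost everywhere; the upper limit is defined and nonincreasing everywhere,
   and so is a nonincreasing representative of [p]. *)
pose L s := limn_esup (h ^~ s).
have L0 s : 0 <= s -> (0 <= L s)%E.
  by move=> s0; apply: limn_esup_ge0 => j; exact: rearr_ge0.
have nL s t : 0 <= s -> s <= t -> (L t <= L s)%E.
  by move=> s0 st; apply: le_limn_esup => j; exact: rearr_le.
have h0 s : 0 <= s -> ~ I s -> h ^~ s = (fun=> 0%E).
  by move=> s0 Is; apply: funext => j; exact: (rearranged_out (dh j)).
have LI s : 0 <= s -> ~ I s -> L s = 0%E.
  move=> s0 Is; rewrite /L h0//.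
  by have [_ ->] := cvg_limn_einf_sup (@cvg_cst _ (0%E : \bar R) nat \oo _).
have pL : eqL0 I (iota p) L.
  by apply: ae_mono hcvg => s /[apply] /cvg_limn_einf_sup[_ <-].
have mL : measurable_fun I L.
  apply: nonincreasing_measurable_fun => //; first exact: domain_measurable.
  exact: domain_ge0.
have Lq : rearr I L = rearr I (iota p).
  by rewrite /rearr (distf_ae hI (bfs_measurable hE p) mL pL).
have pq : eqL0 I (iota p) (rearr I (iota p)).
  by apply: eqL0_trans pL _; rewrite -Lq; exact: rearr_ae_nonincreasing.
split; first by exists p.
move=> t t0.
have [||||||_ _] := @dominated_convergence _ _ _ mu (`[0%R, t]%classic) _ h
  (rearr I (iota p)) G.
- exact: measurable_itv.
- by move=> j; exact: rearr_measurable.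
- exact: rearr_measurable.
- apply: ae_mono2 hcvg pq => s K1 K2 s0t.
  have s0 := segment_ge0 s0t.
  (* For [I = [0, 1[] the segment [0, t] may leave [I]; all rearrangements vanish there. *)
  have [Is|Is] := pselect (I s); first by rewrite -K2//; exact: K1.
  rewrite (rearranged_out (cone_rearranged hI hE p))//.
  by rewrite (h0 _ s0 Is); exact: cvg_cst.
- apply/integrableP; split.
    by apply: (rearranged_measurable _ _ dG) => //; exact: segment_ge0.
  apply: le_lt_trans (Kfunctional_lty hI hE hSKM De t0); rewrite le_eqVlt; apply/orP; left.
  apply/eqP; apply: eq_integral => s /set_mem /segment_ge0 s0.
  rewrite rG// gee0_abs//; exact: (rearranged_ge0 dG).
- apply: aeW => s j s0t; rewrite gee0_abs; last exact: rearr_ge0.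
  by apply: ereal_sup_ubound; exists j.
- by [].
Qed.

(** The factors [c j] are ratios of norms left over from normalization; they disappear in the limit
    because [J p t] is finite. *)
Lemma Kle_fast_limit (z : E) (w : nat -> E) (c : nat -> R) p :
  (forall j, `|w j - p| <= 2^-1 ^+ j) -> (forall j, 0 < c j) ->
  c @ \oo --> (1 : R) -> (forall j, D (w j)) ->
  (forall j, Kle I iota z (c j *: w j)) -> Kle I iota z p.
Proof.
move=> wp c0 c1 Dw zw.
have [Dp Jp] := cone_fast_limit Dw wp.
split; [by case: (zw 0%N)|exact: Dp|] => t t0.
have Jpf : J p t \is a fin_num.
  by rewrite ge0_fin_numE ?Kfunctional_ge0// (Kfunctional_lty hI hE hSKM Dp t0).
have cJ : ((c j)%:E * J (w j) t)%E @[j --> \oo] --> (1%:E * J p t)%E.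
  apply: cvgeM; last exact: Jp.
    by rewrite mule_def_fin.
  by apply: cvg_EFin; [exact: nearW|exact: c1].
rewrite -[leRHS]mul1e; apply: (cvge_to_ge cJ); apply: nearW => j.
have [_ _ H] := zw j.
by rewrite -(Kfunctional_scale hI hE t (c0 j) (Dw j)) H.
Qed.

End ConeLimit.

(** * Rotundity *)

Section Rotund.
Context {R : realType} (I : set R).
Hypothesis hI : I = `[0%R, 1%R[%classic \/ I = `[0%R, +oo[%classic.
Context {E : completeNormedModType R} (iota : E -> R -> \bar R).
Hypothesis hE : banach_function_space I iota.
Hypothesis hFatou : fatou_property I iota.
Local Notation D := (decreasing_cone I iota).
Hypothesis hSKM : strictly_Kmonotone_on I iota D.

Lemma precompact_cluster (z : nat -> E) : precompact (range z) ->
  exists p, forall (e : R) n, 0 < e -> exists2 m, (n <= m)%N & `|z m - p| < e.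
Proof.
rewrite precompactE => cz.
have [|p [_ cp]] := cz (z @ \oo) _.
  by exists 0%N => // n _; apply: subset_closure; exists n.
exists p => e n e0.
have [||_ [[m nm <-] pm]] := cp [set z m | m in [set m | (n <= m)%N]] (ball p e).
- by exists n => // m /= nm; exists m.
- exact: nbhsx_ballx.
by exists m => //; move: pm; rewrite -ball_normE /= distrC.
Qed.

Lemma increasing_geq (s : nat -> nat) : {homo s : m n / (m < n)%N} ->
  forall n, (n <= s n)%N.
Proof. by move=> sm; elim=> // n /leq_ltn_trans; apply; exact: sm. Qed.

Variable k : nat.
Hypothesis hrot : compactly_locally_fully_rotund_on D k.

(** Clustering at [z] is weaker than convergence, but it suffices to contradict a subsequence that
    stays away from its limit. *)
Lemma rotund_cluster (z : E) (z_ : nat -> E) (c : nat -> R) :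
  `|z| = 1 -> D z -> (forall n, `|z_ n| = 1) -> (forall n, D (z_ n)) ->
  (forall n, 0 < c n) -> c @ \oo --> (1 : R) ->
  (forall n, Kle I iota z (c n *: z_ n)) ->
  forall (e : R) n, 0 < e -> exists2 m, (n <= m)%N & `|z_ m - z| < e.
Proof.
move=> z1 Dz zn1 Dzn c0 c1 zc.
have pz : precompact (range z_).
  apply: (hrot (conj z1 Dz) (fun n => conj (zn1 n) (Dzn n))) => s shomo.
  have csub i : (c (s i n) - 1) @[n --> \oo] --> (0 : R).
    rewrite -(subrr (1 : R)); apply: cvgB; last exact: cvg_cst.
    apply: cvg_comp c1 => A [N _ NA]; exists N => // n /= Nn; apply: NA => /=.
    exact: leq_trans Nn (increasing_geq (shomo i) n).
  (* Lower bound for the squeeze: dropping a factor [c (s i n)] in front of a unit vector changes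
     the norm by at most [|c (s i n) - 1|]. *)
  have lo : (k.+1%:R - \sum_(i < k) `|c (s i n) - 1|) @[n --> \oo] --> (k.+1%:R : R).
    rewrite -[X in _ --> X]subr0; apply: cvgB; first exact: cvg_cst.
    have csub' (i : 'I_k) : true -> `|c (s i n) - 1| @[n --> \oo] --> (0 : R).
      move=> _; have := cvg_norm (csub i); rewrite normr0; exact.
    have := cvg_big (op := +%R) (x0 := 0) (P := xpredT) (r := index_enum _)
      (fun x => add_continuous x) _ csub'.
    by rewrite big1; [exact|].
  apply: (@squeeze_cvgr _ _ _ _ _ (cst k.+1%:R) _ _ _ lo (cvg_cst _)).
  apply: nearW => n /=; apply/andP; split.
    have : Kle I iota (z + \sum_(i < k) z) (z + \sum_(i < k) (c (s i n) *: z_ (s i n))).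
      by apply: (Kle_add hI hE); [exact: Kle_refl|apply: (Kle_sum hI hE) => i _; exact: zc].
    move/(Kle_norm hI hE hSKM).
    rewrite sumr_const card_ord -mulrS -scaler_nat normrZ z1 mulr1 ger0_norm// => H.
    rewrite lerBlDr (le_trans H)//.
    have -> : z + \sum_(i < k) (c (s i n) *: z_ (s i n)) =
       (z + \sum_(i < k) z_ (s i n)) + \sum_(i < k) ((c (s i n) - 1) *: z_ (s i n)).
      rewrite -addrA -big_split/=; congr (_ + _); apply: eq_bigr => i _.
      by rewrite scalerBl scale1r addrC subrK.
    rewrite (le_trans (ler_normD _ _))// lerD2l (le_trans (ler_norm_sum _ _ _))//.
    by apply: ler_sum => i _; rewrite normrZ zn1 mulr1.
  rewrite (le_trans (ler_normD _ _))// z1 -natr1 addrC lerD2r.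
  rewrite (le_trans (ler_norm_sum _ _ _))//.
  rewrite (eq_bigr (fun=> 1)); last by move=> i _; rewrite zn1.
  by rewrite sumr_const card_ord.
have [p clp] := precompact_cluster pz.
(* [psi] need not be increasing: [j <= psi j] is enough for [c (psi j)] to tend to 1. *)
have /choice[psi /all_and2[psin psip]] : forall j, exists m,
    (j <= m)%N /\ `|z_ m - p| < 2^-1 ^+ j.
  move=> j; have [|m jm mp] := clp (2^-1 ^+ j) j; first by rewrite exprn_gt0.
  by exists m.
have cpsi : c (psi j) @[j --> \oo] --> (1 : R).
  apply: cvg_comp c1 => A [N _ NA]; exists N => // n /= Nn; apply: NA => /=.
  exact: leq_trans Nn (psin n).
have zp : Kle I iota z p.
  have zpsi j : `|z_ (psi j) - p| <= 2^-1 ^+ j by exact: ltW.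
  exact: (Kle_fast_limit hI hE hFatou hSKM zpsi (fun j => c0 (psi j)) cpsi
    (fun j => Dzn (psi j)) (fun j => zc (psi j))).
have p1 : `|p| = 1.
  apply/eqP; rewrite -subr_eq0 -normr_le0; apply/ler_addgt0Pl => e e0.
  have [m _ mp] := clp e 0%N e0.
  rewrite addr0 -(zn1 m) distrC (le_trans (ler_dist_dist _ _))//.
  exact: ltW.
have -> : z = p by apply: (Kle_norm_eq hI hE hSKM zp); rewrite z1.
exact: clp.
Qed.

End Rotund.

(** * Passage to normalized rearrangements and back *)

Theorem theorem4p9 (R : realType) (I : set R)
    (hI : I = `[0%R, 1%R[%classic \/ I = `[0%R, +oo[%classic)
    (E : completeNormedModType R) (iota : E -> R -> \bar R) (k : nat)
    (hk : (2 <= k)%N)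
    (hsym : symmetric_space I iota) (hFatou : fatou_property I iota)
    (hrot : compactly_locally_fully_rotund_on (decreasing_cone I iota) k)
    (hSKM : strictly_Kmonotone_on I iota (decreasing_cone I iota)) :
  upper_locally_uniformly_Kmonotone I iota.
Proof.
move=> x x_ xx nx.
have hE := sym_bfs hsym.
(* The rearrangement is equimeasurable with [f], so symmetry places it in the space with the same
   norm. *)
have star (f : E) : exists e, [/\ eqL0 I (iota e) (rearr I (iota f)),
    `|e| = `|f|, decreasing_cone I iota e &
    forall t, 0 <= t -> rearr I (iota e) t = rearr I (iota f) t].
  have mf := bfs_measurable hE f.
  have df := rearr_rearranged hI mf.
  have [||e ef nef] := sym_equimeasurable hsym (x := rearr I (iota f)) (f := f).
  - exact: (rearranged_measurable (domain_measurable hI) (@domain_ge0 _ _ hI) df).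
  - exact: distf_rearr.
  by have [De rE] := cone_of_rearranged hI hE df ef; exists e.
have [y [yE yN Dy yr]] := star x.
have /choice[y_ /all_and4[y_E y_N Dy_ y_r]] := fun n => star (x_ n).
exists y, y_; split; [exact: yE|exact: y_E|].
have yy n : Kle I iota y (y_ n).
  split; [exact: Dy|exact: Dy_|]; apply/KprecE => t t0; rewrite /mrearr.
  have JE := Kfunctional_eq t yr; have Kfunctional_E := Kfunctional_eq t (y_r n).
  by rewrite /Kfunctional in JE Kfunctional_E; rewrite JE Kfunctional_E; exact: xx.
have ny : `|y_ n| @[n --> \oo] --> `|y|.
  by rewrite yN (_ : (fun n => `|y_ n|) = (fun n => `|x_ n|))//; apply/funext.
(* Normalization divides by the norm of [y]; for [y = 0] the claim is the convergence of norms
   itself. *)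
have [y0|y0] := eqVneq y 0.
  have -> : (fun n => `|y - y_ n|) = (fun n => `|y_ n|).
    by apply/funext => n; rewrite y0 sub0r normrN.
  by move: ny; rewrite y0 normr0.
have ny0 : 0 < `|y| by rewrite normr_gt0.
have leny n : `|y| <= `|y_ n| by exact: (Kle_norm hI hE hSKM (yy n)).
have ny_0 n : 0 < `|y_ n| by exact: lt_le_trans (leny n).
apply: contrapT => ncvg.
have [e e0 far] : exists2 e : R, 0 < e & forall n, exists m, (n <= m)%N /\ e <= `|y - y_ m|.
  apply: contrapT => /forall2NP H; apply: ncvg.
  apply/cvgr0Pnorm_lt => e e0; have [//|/existsNP[N HN]] := H e.
  exists N => // m /= Nm; rewrite normr_id ltNge; apply/negP => em.
  by apply: HN; exists m.
have /choice[phi /all_and2[phin phie]] := far.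
pose z := `|y|^-1 *: y; pose z_ n := `|y_ (phi n)|^-1 *: y_ (phi n).
have nyphi : `|y_ (phi n)| @[n --> \oo] --> `|y|.
  apply: cvg_comp ny => A [N _ NA]; exists N => // n /= Nn; apply: NA => /=.
  exact: leq_trans Nn (phin n).
(* The ratio of norms turns [z_ n] into [y_ (phi n)] divided by the norm of [y], which dominates [z]
   since [y_ (phi n)] dominates [y]. *)
have clz := @rotund_cluster _ _ hI _ _ hE hFatou hSKM k hrot z z_
  (fun n => `|y|^-1 * `|y_ (phi n)|) _ _ _ _ _ _ _.
have ny0V : 0 < `|y|^-1 by rewrite invr_gt0.
have cz n : (`|y|^-1 * `|y_ (phi n)|) *: z_ n = `|y|^-1 *: y_ (phi n).
  by rewrite /z_ scalerA mulfK// gt_eqF.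
have {}clz : forall (e : R) n, 0 < e -> exists2 m, (n <= m)%N & `|z_ m - z| < e.
  apply: clz.
  - by rewrite normrZ ger0_norm ?invr_ge0// mulVf// gt_eqF.
  - by apply: (coneZ hI hE _ Dy).1; rewrite invr_gt0.
  - by move=> n; rewrite normrZ ger0_norm ?invr_ge0// mulVf// gt_eqF.
  - by move=> n; apply: (coneZ hI hE _ (Dy_ _)).1; rewrite invr_gt0.
  - by move=> n; rewrite mulr_gt0// invr_gt0.
  - by rewrite -(mulVf (lt0r_neq0 ny0)); apply: cvgM => //; exact: cvg_cst.
  - move=> n /=; rewrite cz; exact: (Kle_scale hI hE ny0V (yy _)).
have e2 : 0 < e / 2 by rewrite divr_gt0.
have [N _ HN] : \forall n \near \oo, `| `|y| - `|y_ (phi n)| | < e / 2.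
  by move/cvgrPdist_lt : nyphi => /(_ _ e2).
(* The decomposition below multiplies [z - z_ m] by the norm of [y], hence this tolerance; [N <= m]
   controls the difference of norms. *)
have [|m Nm zm] := clz (e / 2 / `|y|) N; first by rewrite divr_gt0.
have := phie m; rewrite leNgt => /negP; apply.
have -> : y - y_ (phi m) = `|y| *: (z - z_ m) + (`|y| - `|y_ (phi m)|) *: z_ m.
  rewrite scalerBr scalerBl addrA subrK /z /z_ !scalerA !divff ?gt_eqF//.
  by rewrite !scale1r.
have zm1 : `|z_ m| = 1 by rewrite normrZ ger0_norm ?invr_ge0// mulVf// gt_eqF.
apply: (le_lt_trans (ler_normD _ _)); rewrite normrZ normr_id.
rewrite normrZ zm1 mulr1 [ltRHS]splitr.
apply: ltrD; last exact: HN.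
by rewrite distrC mulrC -ltr_pdivlMr.
Qed.
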